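(* The nested sequent calculus $\mathsf{NK}$ for the modal logic $\mathsf{K}$ has the bisimulation nested-sequent uniform interpolation property (BNUIP).
   Context: Modal formulas are in negation normal form: $\varphi ::= \bot \mid \top \mid p \mid \overline{p} \mid (\varphi\land\varphi)\mid(\varphi\lor\varphi)\mid\Box\varphi\mid\Diamond\varphi$. A nested sequent has the form $\varphi_1,\dots,\varphi_n,[\Gamma_1],\dots,[\Gamma_m]$ with the $\Gamma_j$ nested sequents; its formula interpretation is $\varphi_1\lor\dots\lor\varphi_n\lor\Box\iota(\Gamma_1)\lor\dots\lor\Box\iota(\Gamma_m)$. Nodes of the sequent tree are labelled by finite sequences of natural numbers: the root is $1$ and the $i$-th structural box directly inside node $\sigma$ gets label $\sigma * i$; $\mathcal{L}(\Gamma)$ is the set of labels, and $\sigma:\varphi\in\Gamma$ means $\varphi$ occurs directly at node $\sigma$. $\mathsf{NK}$ is Brünnler's terminating (Kleene'd) nested calculus with rules $\mathsf{id_P}$ ($\Gamma\{p,\overline p\}$), $\mathsf{id_\top}$ ($\Gamma\{\top\}$), $\lor$, $\land$, $\Box$ (from $\Gamma\{\Box\varphi,[\varphi]\}$ infer $\Gamma\{\Box\varphi\}$) and $\mathsf{k}$ (from $\Gamma\{\Diamond\varphi,[\Delta,\varphi]\}$ infer $\Gamma\{\Diamond\varphi,[\Delta]\}$); it is sound and complete for $\mathsf{K}$. $\mathsf{K}$-models are finite intransitive, irreflexive directed trees $(W,R,V)$. A multiworld interpretation of $\Gamma$ into a model $\mathcal{M}=(W,R,V)$ is a map $\mathcal{I}:\mathcal{L}(\Gamma)\to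 W$ with $\mathcal{I}(\sigma)R\,\mathcal{I}(\sigma*n)$ whenever both labels are in $\mathcal{L}(\Gamma)$; $\mathcal{M},\mathcal{I}\models\Gamma$ iff $\mathcal{M},\mathcal{I}(\sigma)\models\varphi$ for some $\sigma:\varphi\in\Gamma$. Multiformulas are given by $\mho ::= \sigma:\varphi \mid (\mho \curlywedge \mho) \mid (\mho\curlyvee\mho)$, where $\curlywedge$ and $\curlyvee$ denote multiformula conjunction and disjunction; for $\mathcal{I}$ defined on all labels of $\mho$: $\mathcal{M},\mathcal{I}\models\sigma:\varphi$ iff $\mathcal{M},\mathcal{I}(\sigma)\models\varphi$, $\curlywedge$ is interpreted as ''both'', $\curlyvee$ as ''at least one''. A bisimulation up to an atomic proposition $p$ between models $\mathcal{M}$ and $\mathcal{M}'$ is a nonempty relation $Z$ such that related worlds agree on all atoms $q\neq p$ and satisfy the usual forth and back conditions; $(\mathcal{M},\mathcal{I})\sim_p(\mathcal{M}',\mathcal{I}')$ means there is such $Z$ with $\mathcal{I}(\sigma)Z\mathcal{I}'(\sigma)$ for all $\sigma$ in the common domain. A nested calculus $\mathsf{NL}$ sound and complete for logic $\mathsf{L}$ has the BNUIP if for every nested sequent $\Gamma$ and atomic $p$ there is a multiformula $A_p(\Gamma)$ with: (i) $\mathit{Var}(A_p(\Gamma))\subseteq\mathit{Var}(\Gamma)\setminus\{p\}$ and $\mathcal{L}(A_p(\Gamma))\subseteq\mathcal{L}(\Gamma)$; (ii) for every multiworld interpretation $\mathcal{I}$ of $\Gamma$ into an $\mathsf{L}$-model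 $\mathcal{M}$, $\mathcal{M},\mathcal{I}\models A_p(\Gamma)$ implies $\mathcal{M},\mathcal{I}\models\Gamma$; (iii)$'$ for every $\mathsf{L}$-model $\mathcal{M}$ and multiworld interpretation $\mathcal{I}$ of $\Gamma$ into $\mathcal{M}$, if $\mathcal{M},\mathcal{I}\not\models A_p(\Gamma)$ then there are an $\mathsf{L}$-model $\mathcal{M}'$ and a multiworld interpretation $\mathcal{I}'$ of $\Gamma$ into $\mathcal{M}'$ with $(\mathcal{M}',\mathcal{I}')\sim_p(\mathcal{M},\mathcal{I})$ and $\mathcal{M}',\mathcal{I}'\not\models\Gamma$. *)

(* Defs.v *)
From HB Require Import structures.
From mathcomp Require Import all_boot.

Set Implicit Arguments.
Unset Strict Implicit.
Unset Printing Implicit Defensive.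

Definition atom := nat.

Inductive form : Type :=
| Bot
| Top
| Pos of atom
| Neg of atom
| And of form & form
| Or of form & form
| Box of form
| Dia of form.

Lemma form_comparable : comparable form.
Proof.
by move=> f g; rewrite /decidable; decide equality; apply: (@eq_comparable nat).
Qed.

HB.instance Definition _ := hasDecEq.Build form (compareP form_comparable).

Fixpoint fvars (f : form) : seq atom :=
  match f with
  | Bot | Top => [::]
  | Pos q | Neg q => [:: q]
  | And g h | Or g h => fvars g ++ fvars h
  | Box g | Dia g => fvars g
  end.

(* [Node [:: f1; ..; fn] [:: G1; ..; Gm]] is  f1, .., fn, [G1], .., [Gm]. *)
Inductive nested : Type := Node of seq form & seq nested.

(* A trailing [Bot] closes the disjunction, so that the empty sequent is read
   as falsum. *)
Fixpoint iota_form (G : nested) : form :=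
  let: Node F B := G in
  foldr Or Bot (F ++ [seq Box (iota_form D) | D <- B]).

Fixpoint svars (G : nested) : seq atom :=
  let: Node F B := G in
  flatten [seq fvars f | f <- F] ++ flatten [seq svars D | D <- B].

Definition label := seq nat.

Definition root_label : label := [:: 1].

(* All nodes of the tree of [G] with the formulas standing directly at them;
   [s] is the label of the root of [G] and boxes are numbered from 1. *)
Fixpoint nodes_from (s : label) (G : nested) : seq (label * seq form) :=
  let: Node F B := G in
  (s, F) ::
  (fix boxes (i : nat) (B : seq nested) :=
     if B is D :: B' then nodes_from (rcons s i) D ++ boxes i.+1 B'
     else [::]) 1 B.

Definition nodes (G : nested) := nodes_from root_label G.

Definition labels (G : nested) : seq label := [seq n.1 | n <- nodes G].

Definition occurs (s : label) (f : form) (G : nested) : bool :=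
  (s, f) \in [seq (n.1, g) | n <- nodes G, g <- n.2].

Inductive context : Type :=
| Hole
| Under of seq form & seq nested & context & seq nested.

(* The hole stands for a whole node, i.e. for the displayed part of a rule
   together with all its siblings. *)
Fixpoint fill (C : context) (G : nested) : nested :=
  match C with
  | Hole => G
  | Under F B1 C' B2 => Node F (B1 ++ fill C' G :: B2)
  end.

(* Sequents are multisets in the calculus: a displayed formula may stand
   anywhere in its node, whence the membership side conditions. As every rule
   keeps its principal formula, no formula has to be removed in a premise. *)
Inductive NK : nested -> Prop :=
| NK_idP C F B q :
    Pos q \in F -> Neg q \in F ->
    NK (fill C (Node F B))
| NK_idT C F B :
    Top \in F ->
    NK (fill C (Node F B))
| NK_or C F B f g :
    Or f g \in F ->
    NK (fill C (Node [:: f, g & F] B)) ->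
    NK (fill C (Node F B))
| NK_and C F B f g :
    And f g \in F ->
    NK (fill C (Node (f :: F) B)) ->
    NK (fill C (Node (g :: F) B)) ->
    NK (fill C (Node F B))
| NK_box C F B f :
    Box f \in F ->
    NK (fill C (Node F (rcons B (Node [:: f] [::])))) ->
    NK (fill C (Node F B))
| NK_k C F B1 F' B' B2 f :
    Dia f \in F ->
    NK (fill C (Node F (B1 ++ Node (f :: F') B' :: B2))) ->
    NK (fill C (Node F (B1 ++ Node F' B' :: B2))).

Record model : Type := Model {
  world : finType;
  acc : rel world;
  valuation : atom -> {set world}
}.

Fixpoint sat (M : model) (w : world M) (f : form) : bool :=
  match f with
  | Bot => false
  | Top => true
  | Pos q => w \in valuation M q
  | Neg q => w \notin valuation M q
  | And g h => sat w g && sat w h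
  | Or g h => sat w g || sat w h
  | Box g => [forall v, acc w v ==> sat v g]
  | Dia g => [exists v, acc w v && sat v g]
  end.

Definition intransitive (T : Type) (R : rel T) : Prop :=
  forall x y z, R x y -> R y z -> ~~ R x z.

(* Some root has exactly one directed path to each vertex. *)
Definition directed_tree (T : eqType) (R : rel T) : Prop :=
  exists r : T, forall x : T, exists! s : seq T, path R r s /\ last r s = x.

Definition K_model (M : model) : Prop :=
  [/\ irreflexive (@acc M), intransitive (@acc M) & directed_tree (@acc M)].

(* Interpretations are total functions on labels of which only the values on
   [labels G] are ever used. *)
Definition interpretation (G : nested) (M : model) (I : label -> world M) :
    Prop :=
  forall s n, s \in labels G -> rcons s n \in labels G ->
    acc (I s) (I (rcons s n)).

Definition seq_sat (M : model) (I : label -> world M) (G : nested) : Prop :=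
  exists s f, occurs s f G /\ sat (I s) f.

Inductive mform : Type :=
| MForm of label & form
| MAnd of mform & mform
| MOr of mform & mform.

Fixpoint mvars (A : mform) : seq atom :=
  match A with
  | MForm _ f => fvars f
  | MAnd A1 A2 | MOr A1 A2 => mvars A1 ++ mvars A2
  end.

Fixpoint mlabels (A : mform) : seq label :=
  match A with
  | MForm s _ => [:: s]
  | MAnd A1 A2 | MOr A1 A2 => mlabels A1 ++ mlabels A2
  end.

Fixpoint msat (M : model) (I : label -> world M) (A : mform) : Prop :=
  match A with
  | MForm s f => sat (I s) f
  | MAnd A1 A2 => msat I A1 /\ msat I A2
  | MOr A1 A2 => msat I A1 \/ msat I A2
  end.

Definition bisimulation_upto (p : atom) (M M' : model)
    (Z : world M -> world M' -> Prop) : Prop :=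
  [/\ exists w w', Z w w',
      forall w w' q, Z w w' -> q != p ->
        (w \in valuation M q) = (w' \in valuation M' q),
      forall w w' v, Z w w' -> acc w v -> exists2 v', acc w' v' & Z v v'
    & forall w w' v', Z w w' -> acc w' v' -> exists2 v, acc w v & Z v v'].

(* [dom] is the common domain of [I] and [I']. *)
Definition bisimilar_upto (p : atom) (dom : seq label)
    (M : model) (I : label -> world M)
    (M' : model) (I' : label -> world M') : Prop :=
  exists2 Z : world M -> world M' -> Prop,
    bisimulation_upto p Z & forall s, s \in dom -> Z (I s) (I' s).

(* A logic is given by its class of models. *)
Definition sound_and_complete (NL : nested -> Prop) (L : model -> Prop) :
    Prop :=
  forall G : nested,
    NL G <-> (forall M : model, L M -> forall w : world M, sat w (iota_form G)).

Definition is_BNUI (L : model -> Prop) (p : atom) (G : nested) (A : mform) :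
    Prop :=
  [/\ {subset mvars A <= [seq q <- svars G | q != p]}
        /\ {subset mlabels A <= labels G},
      forall (M : model) (I : label -> world M),
        L M -> interpretation G I -> msat I A -> seq_sat I G
    & forall (M : model) (I : label -> world M),
        L M -> interpretation G I -> ~ msat I A ->
        exists (M' : model) (I' : label -> world M'),
          [/\ L M', interpretation G I',
              bisimilar_upto p (labels G) I' I & ~ seq_sat I' G]].

(* Having the BNUIP presupposes that the calculus is sound and complete. *)
Definition has_BNUIP (NL : nested -> Prop) (L : model -> Prop) : Prop :=
  sound_and_complete NL L /\
  forall (G : nested) (p : atom), exists A : mform, is_BNUI L p G A.

(* Main.v *)
(** Saturating the formulas [F] at a node with respect to the propositional
    connectives splits the task of refuting [F] into branches [b] made of
    literals, boxes and diamonds. A tree refutes [b] iff its root refutes the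
    literals, all its children refute the formulas under the diamonds of [b],
    and each box of [b] is refuted at some child. These conditions on distinct
    children are independent, which has two consequences. First, if no such tree
    exists, then the literals form an axiom, or a single box of [b], or a single
    bracketed subsequent together with the diamonds of [b], is already
    irrefutable; applying this recursively gives a derivation in NK. Second, up
    to bisimulation children can be duplicated freely and the value of [p] at
    the root can be changed, so refutability of [b] up to [p] is expressed by
    the literals other than [p], one modality for each condition on children,
    and the interpolants of the bracketed subsequents enlarged by the diamonds
    of [b]. *)

From mathcomp Require Import all_boot.
Require Import Defs.

Set Implicit Arguments.
Unset Strict Implicit.
Unset Printing Implicit Defensive.

(** * Sequences without decidable equality, and choice along finite sequences *)

Section SeqExtra.

Variables T U : Type.

(* Membership in a sequence over a type without decidable equality. *)
Definition oin (x : T) (s : seq T) : Prop := exists i, onth s i = Some x.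

Lemma oin_cons x y s : oin x (y :: s) <-> x = y \/ oin x s.
Proof.
split; first by case=> -[|i] /=; [case; left | right; exists i].
by case=> [->|[i xi]]; [exists 0 | exists i.+1].
Qed.

Lemma oin_cat x s1 s2 : oin x (s1 ++ s2) <-> oin x s1 \/ oin x s2.
Proof.
elim: s1 => [|y s1 IHs] /=; first by split; [right | case=> // -[[]]].
split=> [/oin_cons[->|/IHs[]]|[/oin_cons[->|]|]] => [|xs|xs||xs|xs].
- by left; apply/oin_cons; left.
- by left; apply/oin_cons; right.
- by right.
- by apply/oin_cons; left.
- by apply/oin_cons; right; apply/IHs; left.
- by apply/oin_cons; right; apply/IHs; right.
Qed.

Lemma has_oinP (P : pred T) s : reflect (exists2 x, oin x s & P x) (has P s).
Proof.
apply: (iffP idP) => [|[x xs Px]].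
  elim: s => //= y s IHs /orP[Py|/IHs[x xs Px]].
    by exists y => //; exists 0.
  by exists x => //; apply/oin_cons; right.
elim: s xs => [[[]]//|y s IHs /oin_cons[<-|/IHs hs]] /=; first by rewrite Px.
by rewrite hs orbT.
Qed.

(** Induction on [s] replaces an axiom of choice. The relation sees the index because the label of a
    bracketed subsequent depends on its position. *)
Lemma finite_choice (R : nat -> T -> U -> Prop) s :
  (forall i x, onth s i = Some x -> exists y, R i x y) ->
  exists2 t, size t = size s &
    forall i x y, onth s i = Some x -> onth t i = Some y -> R i x y.
Proof.
elim: s R => [|x s IHs] R Rs; first by exists [::] => // -[].
have [y Rxy] := Rs 0 x erefl.
have [t szt Rt] := IHs (fun i => R i.+1) (fun i => Rs i.+1).
by exists (y :: t) => [|[|i] ? ? /=];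
  [rewrite /= szt | do 2!case=> <- | apply: Rt].
Qed.

Lemma onth_size_eq i (x : T) (s : seq T) (t : seq U) :
  size t = size s -> onth s i = Some x -> exists y, onth t i = Some y.
Proof.
move=> szt si; have: onth t i by rewrite onthTE szt -onthTE si.
by case: onth => // y; exists y.
Qed.

(** Neither [P] nor [Q x] need be decidable: the induction scans [s] and stops at the first element
    that yields [P]. *)
Lemma or_forall (P : Prop) (Q : T -> Prop) (s : seq T) :
  (forall x, oin x s -> P \/ Q x) -> P \/ forall x, oin x s -> Q x.
Proof.
elim: s => [|x s IHs] PQ; first by right=> y [[]].
have [|Px|Qx] := PQ x; [by exists 0 | by left |].
case: IHs => [y ys|Ps|Qs]; [by apply: PQ; apply/oin_cons; right | by left |].
by right=> y /oin_cons[->|/Qs].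
Qed.

End SeqExtra.

Lemma oin_mem (T : eqType) (x : T) s : oin x s <-> x \in s.
Proof. by split=> [xs|/onthP//]; apply/onthP. Qed.

Lemma finite_image (T : eqType) U (R : T -> U -> Prop) (s : seq T) :
  (forall x, x \in s -> exists y, R x y) ->
  exists t, (forall x, x \in s -> exists2 y, oin y t & R x y) /\
            (forall y, oin y t -> exists2 x, x \in s & R x y).
Proof.
move=> Rs; have [|t szt Rt] := @finite_choice _ U (fun=> R) s.
  by move=> i x si; apply: Rs; apply/onthP; exists i.
exists t; split=> [x /onthP[i si]|y [i ti]].
  by have [y ti] := onth_size_eq szt si; exists y; [exists i | apply: Rt ti].
have [x si] := onth_size_eq (esym szt) ti.
by exists x; [apply/onthP; exists i | apply: Rt ti].
Qed.

(** The generated induction principle gives no hypothesis for the subsequents inside the list [B];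
    an inner induction on [B] supplies them. *)
Lemma nested_onth_ind (P : nested -> Prop) :
  (forall F B, (forall D, oin D B -> P D) -> P (Node F B)) -> forall G, P G.
Proof.
move=> IH; fix IHG 1; case=> F B; apply: IH.
elim: B => [|D B IHB] E [i]; first by clear; rewrite onth0n.
(* Fixing the recursive call at [D] and dropping [IHG] keeps automation from making an unguarded
   call. *)
have PD := IHG D; clear IHG.
by case: i => [[<-]//|i Ei]; apply: IHB; exists i.
Qed.

(** * Propositional saturation *)

(** A conjunctive normal form with modal formulas as atoms: each member of [cl f] is read as a
    disjunction, and [f] is equivalent to their conjunction. Hence refuting [f] means refuting one
    member. *)
Fixpoint cl (f : form) : seq (seq form) :=
  match f with
  | And g h => cl g ++ cl h
  | Or g h => [seq b ++ c | b <- cl g, c <- cl h]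
  | _ => [:: [:: f]]
  end.

Definition cls (F : seq form) : seq (seq form) :=
  foldr (fun f bs => [seq b ++ c | b <- cl f, c <- bs]) [:: [::]] F.

Definition reduced (f : form) : bool :=
  if f is (And _ _ | Or _ _) then false else true.

Definition boolean_valuation (e : form -> bool) : Prop :=
  (forall f g, e (And f g) = e f && e g) /\ (forall f g, e (Or f g) = e f || e g).

Lemma all_has_allpairs (e : pred form) bs cs :
  all (has e) [seq b ++ c | b <- bs, c <- cs] = all (has e) bs || all (has e) cs.
Proof.
elim: bs => //= b bs IHbs; rewrite all_cat all_map IHbs.
rewrite (eq_all (a2 := fun c => has e b || has e c)); last first.
  by move=> c /=; rewrite has_cat.
case: (has e b) => /=; first by rewrite all_predT.
rewrite (eq_all (a2 := has e)) //.
by case: (all _ cs); rewrite ?orbT ?andbF.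
Qed.

Lemma cl_has e f : boolean_valuation e -> all (has e) (cl f) = e f.
Proof.
case=> eA eO; elim: f => [|||| f IHf g IHg|f IHf g IHg|f _|f _]; try by move=> *; rewrite /= orbF andbT.
  by rewrite /= all_cat IHf IHg eA.
by rewrite /= all_has_allpairs IHf IHg eO.
Qed.

Lemma cls_has e F : boolean_valuation e -> all (has e) (cls F) = has e F.
Proof.
by move=> eV; elim: F => //= f F IHF; rewrite all_has_allpairs IHF cl_has.
Qed.

Lemma cl_all (P : pred form) f :
  (forall g h, P (And g h) -> P g && P h) ->
  (forall g h, P (Or g h) -> P g && P h) ->
  P f -> all (all P) (cl f).
Proof.
move=> PA PO; elim: f => //=; try by move=> *; rewrite !andbT.
  by move=> f IHf g IHg /PA/andP[/IHf Pf /IHg Pg]; rewrite all_cat Pf.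
move=> f IHf g IHg /PO/andP[/IHf/allP Pf /IHg/allP Pg].
by apply/allP => _ /allpairsP[[b c] [/= /Pf Pb /Pg Pc ->]]; rewrite all_cat Pb.
Qed.

Lemma cls_all (P : pred form) F :
  (forall g h, P (And g h) -> P g && P h) ->
  (forall g h, P (Or g h) -> P g && P h) ->
  all P F -> all (all P) (cls F).
Proof.
move=> PA PO; elim: F => //= f F IHF /andP[/(cl_all PA PO)/allP Pf /IHF/allP PF].
by apply/allP => _ /allpairsP[[b c] [/= /Pf Pb /PF Pc ->]]; rewrite all_cat Pb.
Qed.

Lemma cl_reduced f : all (all reduced) (cl f).
Proof.
elim: f => //= f IHf g IHg; first by rewrite all_cat IHf.
apply/allP => _ /allpairsP[[b c] [/= bf cg ->]].
by rewrite all_cat (allP IHf) // (allP IHg).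
Qed.

Lemma cls_reduced F : all (all reduced) (cls F).
Proof.
elim: F => //= f F IHF; apply/allP => _ /allpairsP[[b c] [/= bf cF ->]].
by rewrite all_cat (allP (cl_reduced f)) // (allP IHF).
Qed.

Definition dias (b : seq form) : seq form :=
  pmap (fun f => if f is Dia g then Some g else None) b.

Definition boxes (b : seq form) : seq form :=
  pmap (fun f => if f is Box g then Some g else None) b.

Lemma mem_dias g b : (g \in dias b) = (Dia g \in b).
Proof.
rewrite mem_pmap; apply/mapP/idP => [[f fb]|gb]; first by case: f fb => // f fb [->].
by exists (Dia g).
Qed.

Lemma mem_boxes g b : (g \in boxes b) = (Box g \in b).
Proof.
rewrite mem_pmap; apply/mapP/idP => [[f fb]|gb]; first by case: f fb => // f fb [->].
by exists (Box g).
Qed.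

Fixpoint depth (f : form) : nat :=
  match f with
  | And g h | Or g h => maxn (depth g) (depth h)
  | Box g | Dia g => (depth g).+1
  | _ => 0
  end.

(** The inequality is strict so that the bound 0 admits no formula at all, which makes the empty
    list the base case of inductions on [n]. *)
Definition shallow n : pred form := fun f => depth f < n.

Lemma cls_shallow n F : all (shallow n) F -> all (all (shallow n)) (cls F).
Proof. by apply: cls_all => g h; rewrite /shallow /= gtn_max. Qed.

Lemma dias_shallow n b : all (shallow n.+1) b -> all (shallow n) (dias b).
Proof. by move/allP => sb; apply/allP => f; rewrite mem_dias => /sb. Qed.

Definition rank (F : seq form) : nat := \max_(f <- F) (depth f).+1.

Lemma rank_shallow F : all (shallow (rank F)) F.
Proof. by apply/allP => f fF; apply: (@leq_bigmax_seq _ _ _ (fun f => (depth f).+1)). Qed.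

Lemma sub_shallow m n F : m <= n -> all (shallow m) F -> all (shallow n) F.
Proof. by move=> mn; apply: sub_all => f /leq_trans; apply. Qed.

(** * Finite trees as models *)

Inductive tree : Type := TNode of (atom -> bool) & seq tree.

Definition tval (t : tree) := let: TNode V _ := t in V.
Definition kids (t : tree) := let: TNode _ ks := t in ks.

Lemma tree_onth_ind (P : tree -> Prop) :
  (forall V ks, (forall k, oin k ks -> P k) -> P (TNode V ks)) -> forall t, P t.
Proof.
move=> IH; fix IHt 1; case=> V ks; apply: IH.
elim: ks => [|t ks IHks] k [i]; first by clear; rewrite onth0n.
have Pt := IHt t; clear IHt.
by case: i => [[<-]//|i ki]; apply: IHks; exists i.
Qed.

Fixpoint tsat (t : tree) (f : form) : bool :=
  match f with
  | Bot => false
  | Top => true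
  | Pos q => tval t q
  | Neg q => ~~ tval t q
  | And g h => tsat t g && tsat t h
  | Or g h => tsat t g || tsat t h
  | Box g => all (tsat^~ g) (kids t)
  | Dia g => has (tsat^~ g) (kids t)
  end.

Lemma sat_boolean M (w : world M) : boolean_valuation (sat w).
Proof. by []. Qed.

Lemma tsat_boolean t : boolean_valuation (tsat t).
Proof. by []. Qed.

Definition falsifies (t : tree) (F : seq form) : bool := ~~ has (tsat t) F.

Lemma falsifies_cls t F b : b \in cls F -> falsifies t b -> falsifies t F.
Proof.
move=> bF tb; rewrite /falsifies -(cls_has _ (tsat_boolean t)) -has_predC.
by apply/hasP; exists b.
Qed.

Lemma falsifies_branch V ks b :
  all reduced b -> Top \notin b ->
  (forall q, Pos q \in b -> ~~ V q) -> (forall q, Neg q \in b -> V q) ->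
  (forall f, Box f \in b -> exists2 k, oin k ks & ~~ tsat k f) ->
  (forall k, oin k ks -> falsifies k (dias b)) ->
  falsifies (TNode V ks) b.
Proof.
move=> rb nT nP nN nB nD; apply/hasPn => -[] //=.
- by move=> Tb; rewrite Tb in nT.
- by move=> q /nN ->.
- by move=> g h /(allP rb).
- by move=> g h /(allP rb).
- move=> g /nB[k kks kg]; rewrite -has_predC; apply/has_oinP.
  by exists k.
- move=> g gb; apply/negP => /has_oinP[k /nD/hasPn kD kg].
  by have := kD g; rewrite mem_dias gb kg => /(_ isT).
Qed.

Definition kid (t : tree) (i : nat) : option tree :=
  if i is j.+1 then onth (kids t) j else None.

(* As for labels of sequents, children are numbered from 1; the root of a tree
   has position [::]. *)
Fixpoint subtree (t : tree) (x : seq nat) : option tree :=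
  if x is i :: y then obind (subtree^~ y) (kid t i) else Some t.

Lemma subtree_cat t x y : subtree t (x ++ y) = obind (subtree^~ y) (subtree t x).
Proof. by elim: x t => //= i x IHx t; case: kid. Qed.

Lemma subtree_rcons t x i : subtree t (rcons x i) = obind (kid^~ i) (subtree t x).
Proof.
by rewrite -cats1 subtree_cat; case: subtree => //= s; case: kid.
Qed.

Fixpoint positions (t : tree) : seq (seq nat) :=
  let: TNode _ ks := t in
  let ps := [seq positions k | k <- ks] in
  [::] :: [seq i.+1 :: x | i <- iota 0 (size ps), x <- nth [::] ps i].

Lemma mem_positions t x : (x \in positions t) = subtree t x.
Proof.
elim/tree_onth_ind: t x => V ks IHks [|i x] //=; rewrite inE /= size_map.
apply/allpairsPdep/idP => [[j [y [_ + [-> ->]]]]|].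
  rewrite -odflt_onth onth_map /=; case kj: (onth ks j) => [k|] //=.
  by rewrite IHks //; exists j.
case: i => //= i; case ki: (onth ks i) => [k|] //= kx.
exists i, x; split=> //; first by rewrite mem_iota /= -onthTE ki.
by rewrite -odflt_onth onth_map ki /= IHks //; exists i.
Qed.

Section TreeModel.

Variable t : tree.

(** Worlds are positions rather than subtrees, so that equal subtrees at different places stay
    distinct and the frame is a tree. *)
Definition tworld : finType := seq_sub (positions t).

Definition tat (x : tworld) : tree := odflt t (subtree t (val x)).

(** The parent of a position is obtained by deleting its last entry. The test for [[::]] is needed
    because the root would otherwise be its own parent. *)
Definition tree_model : model :=
  @Model tworld (fun x y => (val y != [::]) && (val x == take (size (val y)).-1 (val y)))
    (fun q => [set x | tval (tat x) q]).

Lemma subtree_tat (x : tworld) : subtree t (val x) = Some (tat x).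
Proof.
rewrite /tat; have := valP x; rewrite mem_positions.
by case: subtree.
Qed.

Lemma tree_accP (x y : world tree_model) :
  reflect (exists i, val y = rcons (val x) i) (acc x y).
Proof.
rewrite /acc /=; case: (lastP (val y)) => [|s i] /=; first by constructor=> -[i]; case: (val x).
have -> : (rcons s i == [::]) = false by case: s.
rewrite size_rcons /= -cats1 take_size_cat //=; apply: (iffP eqP) => [->|[j]].
  by exists i; rewrite cats1.
by rewrite cats1 => /rcons_inj[->].
Qed.

Definition at_pos (x : seq nat) (k : tree) (xk : subtree t x = Some k) : tworld :=
  SeqSub (etrans (mem_positions t x) (congr1 isSome xk)).

Lemma tat_at_pos x k (xk : subtree t x = Some k) : tat (at_pos xk) = k.
Proof. by rewrite /tat /= xk. Qed.

Definition troot : tworld := at_pos (erefl : subtree t [::] = Some t).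

Lemma oin_kidsP (x : tworld) k :
  oin k (kids (tat x)) <-> exists2 y : tworld, @acc tree_model x y & tat y = k.
Proof.
split=> [[i ki]|[y /tree_accP[i yE] <-]].
  have xi : subtree t (rcons (val x) i.+1) = Some k.
    by rewrite subtree_rcons subtree_tat.
  exists (at_pos xi); last exact: tat_at_pos.
  by apply/tree_accP; exists i.+1.
have := subtree_tat y; rewrite yE subtree_rcons subtree_tat /=.
by case: i {yE} => //= i; exists i.
Qed.

Lemma sat_tree_model (x : world tree_model) f : sat x f = tsat (tat x) f.
Proof.
elim: f x => //= [q|q|f IHf g IHg|f IHf g IHg|f IHf|f IHf] x; rewrite ?inE ?IHf ?IHg //.
  apply/forallP/idP => [xf|xf y].
    rewrite -[all _ _]negbK -has_predC; apply/has_oinP => -[k /oin_kidsP[y xy <-]] /=.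
    by have /implyP/(_ xy) := xf y; rewrite IHf => ->.
  apply/implyP => xy; rewrite IHf; apply: contraLR xf => yf.
  rewrite -has_predC; apply/has_oinP; exists (tat y) => //.
  by apply/oin_kidsP; exists y.
apply/existsP/has_oinP => [[y /andP[xy yf]]|[k /oin_kidsP[y xy <-] kf]].
  by exists (tat y); [apply/oin_kidsP; exists y | rewrite -IHf].
by exists y; apply/andP; split; rewrite ?IHf.
Qed.

(** Both paths are peeled from the end: a position determines its parent by injectivity of [rcons],
    and the root has no parent. *)
Lemma tree_path_unique (x : world tree_model) s1 s2 :
  path (@acc tree_model) troot s1 -> path (@acc tree_model) troot s2 ->
  last troot s1 = x -> last troot s2 = x -> s1 = s2.
Proof.
elim/last_ind: s1 x s2 => [|s1 y1 IHs] x s2; case/lastP: s2 => [|s2 y2] //=.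
- rewrite last_rcons rcons_path => _ /andP[_ /tree_accP[i yi]] <- y2E.
  by move: yi; rewrite y2E /=; case: (val _).
- rewrite last_rcons rcons_path => /andP[_ /tree_accP[i yi]] _ y1E xE.
  by move: yi; rewrite y1E -xE /=; case: (val _).
rewrite !last_rcons !rcons_path => /andP[p1 /tree_accP[i e1]] /andP[p2 /tree_accP[j e2]].
move=> y1x y2x; rewrite y1x y2x; congr rcons.
apply: (IHs (last troot s2)) => //; apply: val_inj.
by move: e1 e2; rewrite y1x y2x => -> /rcons_inj[].
Qed.

(** Each edge lengthens the position by exactly one, which excludes loops and shortcuts; the
    prefixes of a position form the path to it. *)
Lemma tree_model_K : K_model tree_model.
Proof.
split.
- move=> x; apply/tree_accP => -[i /(congr1 size)/eqP].
  by rewrite size_rcons -[X in X == _]addn0 -addn1 eqn_add2l.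
- move=> x y z /tree_accP[i yE] /tree_accP[j zE]; apply/tree_accP => -[k].
  rewrite zE yE => /(congr1 size)/eqP.
  by rewrite !size_rcons eqSS -[X in _ == X]addn0 -addn1 eqn_add2l.
exists troot => x.
suff [s ps sx] : exists2 s, path (@acc tree_model) troot s & last troot s = x.
  by exists s; split=> // s' [ps' sx']; apply: tree_path_unique sx sx'.
case: x => x xt; elim/last_ind: x xt => [|x i IHx] xt.
  by exists [::] => //; apply: val_inj.
have xt' : x \in positions t.
  by move: xt; rewrite !mem_positions subtree_rcons; case: subtree.
have [s ps sx] := IHx xt'; exists (rcons s (SeqSub xt)); last by rewrite last_rcons.
by rewrite rcons_path ps sx; apply/tree_accP; exists i.
Qed.

End TreeModel.

(** * Soundness and completeness of NK *)

Lemma sat_boxP M (w : world M) f :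
  reflect (forall v, acc w v -> sat v f) (sat w (Box f)).
Proof.
by apply: (iffP forallP) => h v; [move/(implyP (h v)) | apply/implyP/h].
Qed.

Lemma sat_diaP M (w : world M) f :
  reflect (exists2 v, acc w v & sat v f) (sat w (Dia f)).
Proof.
apply: (iffP existsP) => [[v /andP[]]|[v wv vf]]; first by exists v.
by exists v; rewrite wv.
Qed.

Lemma sat_disj M (w : world M) F : sat w (foldr Or Bot F) = has (sat w) F.
Proof. by elim: F => //= f F ->. Qed.

Lemma tsat_disj t F : tsat t (foldr Or Bot F) = has (tsat t) F.
Proof. by elim: F => //= f F ->. Qed.

Lemma sat_iota M (w : world M) F B :
  sat w (iota_form (Node F B)) =
  has (sat w) F || has (fun D => sat w (Box (iota_form D))) B.
Proof. by rewrite [iota_form _]/= sat_disj has_cat has_map. Qed.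

Lemma sat_iota_cat M (w : world M) F B1 D B2 :
  let sat_box := has (fun D => sat w (Box (iota_form D))) in
  sat w (iota_form (Node F (B1 ++ D :: B2))) =
  [|| has (sat w) F, sat_box B1, sat w (Box (iota_form D)) | sat_box B2].
Proof. by rewrite sat_iota has_cat. Qed.

Lemma tsat_iota t F B :
  tsat t (iota_form (Node F B)) =
  has (tsat t) F || has (fun D => tsat t (Box (iota_form D))) B.
Proof. by rewrite [iota_form _]/= tsat_disj has_cat has_map. Qed.

(** The implication is assumed at all worlds because entering a bracket moves to successors. Two
    premises serve the rule [NK_and]. *)
Lemma fill_sound2 M C G1 G2 G3 :
  (forall w : world M, sat w (iota_form G1) -> sat w (iota_form G2) ->
    sat w (iota_form G3)) ->
  forall w : world M, sat w (iota_form (fill C G1)) ->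
    sat w (iota_form (fill C G2)) -> sat w (iota_form (fill C G3)).
Proof.
move=> G123; elim: C => [|F B1 C IHC B2] w; first exact: G123.
rewrite 3![fill _ _]/= !sat_iota_cat.
case: (has _ F) => //=; case: (has _ B1) => //=; case: (has _ B2); rewrite ?orbT ?orbF //.
by move=> /sat_boxP h1 /sat_boxP h2; apply/sat_boxP => v wv; apply: IHC; auto.
Qed.

Lemma fill_sound1 M C G1 G2 :
  (forall w : world M, sat w (iota_form G1) -> sat w (iota_form G2)) ->
  forall w : world M, sat w (iota_form (fill C G1)) -> sat w (iota_form (fill C G2)).
Proof. by move=> G12 w h; apply: (fill_sound2 (G1 := G1) (G2 := G1)) => // v /G12. Qed.

Lemma fill_sound0 M C G :
  (forall w : world M, sat w (iota_form G)) ->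
  forall w : world M, sat w (iota_form (fill C G)).
Proof.
move=> hG; elim: C => [|F B1 C IHC B2] w //; rewrite [fill _ _]/= sat_iota_cat.
by apply/or4P/Or43/sat_boxP => v _; apply: IHC.
Qed.

Lemma NK_sound G : NK G -> forall M (w : world M), sat w (iota_form G).
Proof.
move=> dG M; elim: G / dG.
- move=> C F B q Fp Fn; apply: fill_sound0 => w; rewrite sat_iota; apply/orP; left.
  apply/hasP; case wq: (w \in valuation M q); first by exists (Pos q).
  by exists (Neg q); rewrite //= wq.
- move=> C F B FT; apply: fill_sound0 => w; rewrite sat_iota; apply/orP; left.
  by apply/hasP; exists Top.
- move=> C F B f g Ffg _ IH w; apply: fill_sound1 (IH w) => v.
  rewrite !sat_iota /= orbA => /orP[/orP[fg|->//]|->]; last by rewrite orbT.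
  by apply/orP; left; apply/hasP; exists (Or f g).
- move=> C F B f g Ffg _ IHf _ IHg w; apply: fill_sound2 (IHf w) (IHg w) => v.
  rewrite !sat_iota /= -!orbA => /orP[vf|->//] /orP[vg|->//].
  by apply/orP; left; apply/hasP; exists (And f g); rewrite //= vf.
- move=> C F B f Ff _ IH w; apply: fill_sound1 (IH w) => v.
  rewrite !sat_iota has_rcons => /orP[->//|/orP[vf|->]]; last by rewrite orbT.
  apply/orP; left; apply/hasP; exists (Box f) => //.
  apply/sat_boxP => u vu; move/sat_boxP/(_ u vu): vf.
  by rewrite sat_iota /= !orbF.
move=> C F B1 F' B' B2 f Ff _ IH w; apply: fill_sound1 (IH w) => v.
rewrite !sat_iota_cat => /orP[->//|].
(* If [Dia f] fails at [v], then [f] fails at every successor, so its copy in the bracket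
   contributes nothing. *)
have [vf|nf] := boolP (sat v (Dia f)).
  by move=> _; apply/orP; left; apply/hasP; exists (Dia f).
case/or3P=> [->|/sat_boxP h|->]; rewrite ?orbT //.
apply/or4P/Or43/sat_boxP => u vu; move: (h u vu); rewrite !sat_iota /=.
by case uf: (sat u f) => //; case/negP: nf; apply/sat_diaP; exists u.
Qed.

(** * Completeness: a derivation or a refuting tree *)

Fixpoint context_comp (C C' : context) : context :=
  if C is Under F B1 C1 B2 then Under F B1 (context_comp C1 C') B2 else C'.

Lemma fill_comp C C' G : fill (context_comp C C') G = fill C (fill C' G).
Proof. by elim: C => //= F B1 C -> B2. Qed.

(* Weakening is built in, because the rules keep their principal formulas and
   hence only ever enlarge the set of formulas at a node. *)
Definition derivable (F : seq form) (B : seq nested) : Prop :=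
  forall C F', {subset F <= F'} -> NK (fill C (Node F' B)).

(** The propositional rules read upwards: [NK_and] splits the branches, [NK_or] joins them. The node
    [F'] reached at a leaf still contains [F], since principal formulas are kept. *)
Lemma NK_cl C B f F :
  f \in F ->
  (forall b F', b \in cl f -> {subset b <= F'} -> {subset F <= F'} ->
    NK (fill C (Node F' B))) ->
  NK (fill C (Node F B)).
Proof.
have leaf g G : g \in G -> (forall b F', b \in [:: [:: g]] -> {subset b <= F'} ->
    {subset G <= F'} -> NK (fill C (Node F' B))) -> NK (fill C (Node G B)).
  move=> gG; apply; [exact: mem_head | by move=> h; rewrite inE => /eqP-> | by []].
elim: f F => //=; try by move=> *; apply: leaf; eauto.
- move=> f IHf g IHg F fgF H; apply: (NK_and fgF).
    apply: IHf => [|b F' bf sb sF]; first exact: mem_head.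
    by apply: (H b) => // [|h hF]; rewrite ?mem_cat ?bf // sF // inE hF orbT.
  apply: IHg => [|b F' bg sb sF]; first exact: mem_head.
  by apply: (H b) => // [|h hF]; rewrite ?mem_cat ?bg ?orbT // sF // inE hF orbT.
- move=> f IHf g IHg F fgF H; apply: (NK_or fgF).
  apply: IHf => [|b F' bf sb sF]; first exact: mem_head.
  apply: IHg => [|c F'' cg sc sF']; first by rewrite sF // !inE eqxx orbT.
  apply: (H (b ++ c)).
  + by apply/allpairsP; exists (b, c).
  + by move=> h; rewrite mem_cat => /orP[/sb/sF'|/sc].
  + by move=> h hF; rewrite sF' // sF // !inE hF !orbT.
Qed.

Lemma derivable_cls F B : (forall b, b \in cls F -> derivable b B) -> derivable F B.
Proof.
move=> dF C F0 sF0.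
(* The actual node [F'] grows while the members of [F] are saturated one by one, so the two are
   separated before the induction. *)
suff: forall F', {subset F <= F'} -> (forall b F'', b \in cls F -> {subset b <= F''} ->
    {subset F' <= F''} -> NK (fill C (Node F'' B))) -> NK (fill C (Node F' B)).
  by apply=> // b F' bF sb _; apply: (dF b).
elim: F {dF sF0 F0} => [|f F IHF] F' sF H; first exact: (H [::]).
apply: (@NK_cl C B f) => [|b F1 bf sb sF1]; first by rewrite sF ?mem_head.
apply: IHF => [g gF|c F2 cF sc sF2]; first by rewrite sF1 // sF // inE gF orbT.
apply: (H (b ++ c)); first by apply/allpairsP; exists (b, c).
  by move=> g; rewrite mem_cat => /orP[/sb/sF2|/sc].
by move=> g /sF1/sF2.
Qed.

Lemma NK_dias C F B1 F' B' B2 E :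
  {subset E <= dias F} ->
  NK (fill C (Node F (B1 ++ Node (E ++ F') B' :: B2))) ->
  NK (fill C (Node F (B1 ++ Node F' B' :: B2))).
Proof.
elim: E => //= f E IHE sE dE; apply: IHE => [g gE|].
  by rewrite sE // inE gE orbT.
by apply: (@NK_k _ _ _ _ _ _ f) => //; rewrite -mem_dias sE ?mem_head.
Qed.

Lemma oin_split (T : Type) (x : T) s : oin x s -> exists s1 s2, s = s1 ++ x :: s2.
Proof.
elim: s => [[[]]//|y s IHs /oin_cons[<-|/IHs[s1 [s2 ->]]]]; first by exists [::], s.
by exists (y :: s1), s2.
Qed.

Lemma sub_dias F F' : {subset F <= F'} -> {subset dias F <= dias F'}.
Proof. by move=> sF f; rewrite !mem_dias => /sF. Qed.

(** [derivable] quantifies over all contexts, so the derivation for the child can be run inside the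
    parent once [NK_k] has copied the formulas under the diamonds into the bracket. *)
Lemma derivable_kid b B F' B' :
  oin (Node F' B') B -> derivable (dias b ++ F') B' -> derivable b B.
Proof.
move=> DB d C F sF; have [B1 [B2 ->]] := oin_split DB.
apply: (@NK_dias _ _ _ _ _ _ (dias b)); first exact: sub_dias.
by have := d (context_comp C (Under F B1 Hole B2)) (dias b ++ F'); rewrite fill_comp; apply.
Qed.

Lemma derivable_box b B f :
  Box f \in b -> derivable (f :: dias b) [::] -> derivable b B.
Proof.
move=> fb d C F sF; apply: (@NK_box _ _ _ f); first exact: sF.
rewrite -cats1; apply: (@NK_dias _ _ _ _ _ _ (dias b)); first exact: sub_dias.
have := d (context_comp C (Under F B Hole [::])) (dias b ++ [:: f]).
rewrite fill_comp; apply.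
by move=> g; rewrite mem_cat !inE orbC.
Qed.

(** This is falsity of [iota_form (Node F B)] at the root of a tree, with the boxes of the brackets
    unfolded. *)
Definition refutable F B : Prop :=
  exists2 t, falsifies t F &
    forall D, oin D B -> exists2 k, oin k (kids t) & ~~ tsat k (iota_form D).

(** One axiom or one derivable child problem suffices to derive [b]; otherwise the refuting trees of
    all child problems are hung below a common root. *)
Lemma derivable_or_refutable_branch b B :
  all reduced b ->
  (forall f, Box f \in b -> derivable (f :: dias b) [::] \/ refutable (f :: dias b) [::]) ->
  (forall F' B', oin (Node F' B') B ->
    derivable (dias b ++ F') B' \/ refutable (dias b ++ F') B') ->
  derivable b B \/ refutable b B.
Proof.
move=> rb boxb kidb.
have [Tb|nT] := boolP (Top \in b).
  by left=> C F' sF; apply: NK_idT; apply: sF.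
have [/hasP[[]// q qb nqb]|/hasPn nlit] :=
    boolP (has (fun f => if f is Pos q then Neg q \in b else false) b).
  by left=> C F' sF; apply: (@NK_idP _ _ _ q); apply: sF.
have [f /oin_mem|//|fbox] := @or_forall _ (derivable b B)
    (fun f => refutable (f :: dias b) [::]) (boxes b).
  rewrite mem_boxes => fb; case: (boxb f fb) => [d|]; last by right.
  by left; apply: derivable_box d.
  by left.
have [[F' B'] D|//|fkid] := @or_forall _ (derivable b B)
    (fun D => let: Node F' B' := D in refutable (dias b ++ F') B') B.
  by case: (kidb F' B' D) => [d|]; [left; apply: derivable_kid d | right].
  by left.
right.
have [f|fs [fsP1 fsP2]] := @finite_image _ tree
    (fun f t => falsifies t (f :: dias b)) (boxes b).
  by move=> /oin_mem/fbox[t ft _]; exists t.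
have [i [F' B'] Bi|ts szts tsP] := @finite_choice _ tree
    (fun _ D t => falsifies t (dias b) /\ ~~ tsat t (iota_form D)) B.
  have [|t] := fkid (Node F' B'); first by exists i.
  rewrite /falsifies has_cat negb_or => /andP[tb tF'] tB'; exists t; split=> //.
  rewrite tsat_iota negb_or tF'; apply/has_oinP => -[D /tB'[k kt kD] /=].
  by rewrite -[all _ _]negbK -has_predC => /has_oinP[]; exists k.
(* Making [q] true exactly when [Neg q] is in [b] refutes all literals, as no complementary pair is
   left. The children [ts] refute the brackets and [fs] the boxes. *)
exists (TNode (fun q => Neg q \in b) (ts ++ fs)) => /= [|D [i Bi]]; last first.
  have [t ti] := onth_size_eq szts Bi; have [_ tD] := tsP _ _ _ Bi ti.
  by exists t => //; apply/oin_cat; left; exists i.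
apply: falsifies_branch => // [q /nlit//|f|k /oin_cat[[i ki]|/fsP2[f _]]].
- rewrite -mem_boxes => /fsP1[t tf]; rewrite /falsifies /= negb_or => /andP[tnf _].
  by exists t => //; apply/oin_cat; right.
- by have [D Bi] := onth_size_eq (esym szts) ki; have [] := tsP _ _ _ Bi ki.
- by rewrite /falsifies /= negb_or => /andP[].
Qed.

Lemma derivable_or_refutable_cls F B :
  (forall b, b \in cls F -> derivable b B \/ refutable b B) ->
  derivable F B \/ refutable F B.
Proof.
move=> H; have [b /oin_mem bF||dF] := @or_forall _ (refutable F B)
    (fun b => derivable b B) (cls F).
- case: (H b bF) => [|[t tb tB]]; [by right | left; exists t => //].
  exact: falsifies_cls tb.
- by right.
- by left; apply: derivable_cls => b /oin_mem/dF.
Qed.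

(** Saturation does not raise the modal depth, and passing below a box or a diamond lowers it. *)
Lemma derivable_or_refutable_seq n F :
  all (shallow n) F -> derivable F [::] \/ refutable F [::].
Proof.
elim: n F => [|n IHn] F.
  by case: F => // _; right; exists (TNode xpred0 [::]) => // D [[]].
move=> /cls_shallow sF; apply: derivable_or_refutable_cls => b bF.
have sb := allP sF b bF.
apply: derivable_or_refutable_branch => [|f fb|? ? [[]]//].
  exact: (allP (cls_reduced F)).
by apply: IHn; rewrite /= dias_shallow // andbT; apply: (allP sb) fb.
Qed.

(** Brackets are subterms, so induction on [G] suffices provided [E] is arbitrary: it receives the
    formulas under the diamonds of the parent. New boxes create nodes without brackets, for which
    the preceding lemma applies. *)
Lemma derivable_or_refutable G E :
  let: Node F B := G in derivable (E ++ F) B \/ refutable (E ++ F) B.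
Proof.
elim/nested_onth_ind: G E => F B IHB E; apply: derivable_or_refutable_cls => b bF.
apply: derivable_or_refutable_branch => [|f fb|F' B' D].
- exact: (allP (cls_reduced (E ++ F))).
- exact: derivable_or_refutable_seq (rank_shallow _).
- exact: (IHB _ D).
Qed.

Lemma NK_sound_and_complete : sound_and_complete NK K_model.
Proof.
move=> G; split=> [dG M _ w|valG]; first exact: NK_sound.
case: G valG => F B valG; case: (derivable_or_refutable (Node F B) [::]) => [d|].
  exact: (d Hole).
case=> t /= tF tB; have := valG _ (tree_model_K t) (troot t).
rewrite sat_tree_model tat_at_pos tsat_iota (negPf tF) /= => /has_oinP[D /tB[k kt kD]] /=.
by rewrite -[all _ _]negbK -has_predC => /has_oinP[]; exists k.
Qed.

(** * Bisimilar trees *)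

Section TreeBisimulation.

Variables (M : model) (p : atom).

(** Trees are well-founded, so an inductive definition already captures bisimilarity up to [p]. *)
Inductive tbisim : tree -> world M -> Prop :=
  TBisim t w of
    (forall q, q != p -> tval t q = (w \in valuation M q)) &
    (forall k, oin k (kids t) -> exists2 v, acc w v & tbisim k v) &
    (forall v, acc w v -> exists2 k, oin k (kids t) & tbisim k v) :
  tbisim t w.

Lemma tbisim_atom t w :
  tbisim t w -> forall q, q != p -> tval t q = (w \in valuation M q).
Proof. by case. Qed.

Lemma tbisim_back t w :
  tbisim t w -> forall k, oin k (kids t) -> exists2 v, acc w v & tbisim k v.
Proof. by case. Qed.

Lemma tbisim_forth t w :
  tbisim t w -> forall v, acc w v -> exists2 k, oin k (kids t) & tbisim k v.
Proof. by case. Qed.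

(** A cycle through [w] would extend the path from the root to [w] to a second, longer one. *)
Lemma K_model_acyclic (w v : world M) :
  K_model M -> acc w v -> connect (@acc M) v w -> False.
Proof.
case=> _ _ [r rP] wv /connectP[c pc cw].
have [s [[ps sw] us]] := rP w.
have : s = s ++ v :: c.
  by apply: us; rewrite cat_path last_cat /= ps sw wv.
by move/(congr1 size)/eqP; rewrite size_cat /= -[X in X == _]addn0 eqn_add2l.
Qed.

Lemma K_model_ind (P : world M -> Prop) :
  K_model M -> (forall w, (forall v, acc w v -> P v) -> P w) -> forall w, P w.
Proof.
(* The measure is the number of worlds reachable from [w]; a successor loses at least [w] itself. *)
move=> KM IH w; have [n] := ubnP #|connect (@acc M) w|.
elim: n w => // n IHn w le_n; apply: IH => v wv; apply: IHn.
rewrite -ltnS; apply: leq_trans le_n; rewrite ltnS; apply: proper_card.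
apply/properP; split.
  by apply/subsetP => x vx; apply: connect_trans vx; apply: connect1.
by exists w; [apply: connect0 | apply/negP => /(K_model_acyclic KM wv)].
Qed.

Lemma unravelling (w : world M) : K_model M -> exists t, tbisim t w.
Proof.
move=> KM; move: w; apply: K_model_ind => // w IHw.
have [v|ks [ks1 ks2]] := @finite_image _ tree (fun v k => tbisim k v) (enum (acc w)).
  by rewrite mem_enum => /IHw.
exists (TNode (fun q => w \in valuation M q) ks); constructor=> //= [k|v wv].
  by case/ks2=> v; rewrite mem_enum; exists v.
by have [|k] := ks1 v; [rewrite mem_enum | exists k].
Qed.

End TreeBisimulation.

(** * Uniform interpolants *)

(** The literals on [p] are erased, except that a complementary pair becomes [Top], being true
    whatever the value of [p]. The test at [Pos p] alone detects the pair. *)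
Definition lit_interp (p : atom) (b : seq form) (f : form) : form :=
  match f with
  | Top => Top
  | Pos q => if q == p then (if Neg p \in b then Top else Bot) else f
  | Neg q => if q == p then Bot else f
  | _ => Bot
  end.

(** Let [U] give interpolants for smaller depth. Then [Dia (U (dias b))] fails when every successor
    can, up to [p], refute [dias b], and [Box (U (f :: dias b))] fails when some successor can
    refute [f] as well. *)
Definition branch_interp (U : seq form -> form) (p : atom) (b : seq form) : form :=
  foldr Or Bot ([seq lit_interp p b f | f <- b] ++
    Dia (U (dias b)) :: [seq Box (U (f :: dias b)) | f <- boxes b]).

(* [n] must exceed the modal depth of all formulas in [F]; for [n = 0] this means
   that [F] is empty. *)
Fixpoint seq_interp (p : atom) (n : nat) (F : seq form) : form :=
  if n is m.+1
  then foldr And Top [seq branch_interp (seq_interp p m) p b | b <- cls F]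
  else Bot.

Lemma sat_conj M (w : world M) F : sat w (foldr And Top F) = all (sat w) F.
Proof. by elim: F => //= f F ->. Qed.

Lemma sat_branch_interp M (w : world M) U p b :
  sat w (branch_interp U p b) =
  [|| has (sat w) [seq lit_interp p b f | f <- b], sat w (Dia (U (dias b))) |
      has (fun f => sat w (Box (U (f :: dias b)))) (boxes b)].
Proof. by rewrite /branch_interp sat_disj has_cat; congr orb; apply: (congr1 (orb _)); apply: has_map. Qed.

Lemma branch_interp_sound M U p b (w : world M) :
  (forall F (v : world M), sat v (U F) -> has (sat v) F) ->
  sat w (branch_interp U p b) -> has (sat w) b.
Proof.
move=> Usound; rewrite sat_branch_interp => /or3P[|/sat_diaP[v wv]|].
- rewrite has_map => /hasP[f fb].
  case: f fb => //= [Tb _|q qb|q qb]; first by apply/hasP; exists Top.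
    case: eqP => [qp|_ wq]; last by apply/hasP; exists (Pos q).
    case: ifP => // npb _; apply/hasP.
    case wp: (w \in valuation M p); last by exists (Neg p); rewrite //= wp.
    by exists (Pos p); rewrite // -qp.
  by case: eqP => [//|_ wq]; apply/hasP; exists (Neg q).
- move=> /Usound/hasP[f]; rewrite mem_dias => fb vf.
  by apply/hasP; exists (Dia f) => //; apply/sat_diaP; exists v.
move=> /hasP[f]; rewrite mem_boxes => fb /sat_boxP wU.
(* Unless a diamond of [b] holds at [w], all successors refute [dias b], so there [U (f :: dias b)]
   can only be true because of [f]. *)
have [/hasP[g gd wg]|/hasPn nd] := boolP (has (fun g => sat w (Dia g)) (dias b)).
  by apply/hasP; exists (Dia g); rewrite -?mem_dias.
apply/hasP; exists (Box f) => //; apply/sat_boxP => v wv.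
have := Usound _ _ (wU v wv); rewrite /= => /orP[//|/hasP[g gd vg]].
by case/negP: (nd g gd); apply/sat_diaP; exists v.
Qed.

Lemma seq_interp_sound M p n F (w : world M) :
  sat w (seq_interp p n F) -> has (sat w) F.
Proof.
elim: n F w => //= n IHn F w; rewrite sat_conj all_map => /allP Fw.
rewrite -(cls_has _ (sat_boolean w)); apply/allP => b /Fw /=.
exact: branch_interp_sound.
Qed.

Definition interp_complete M p n (U : seq form -> form) : Prop :=
  forall F (v : world M), all (shallow n) F -> ~~ sat v (U F) ->
  exists2 t, tbisim p t v & falsifies t F.

(* The atom p may be given any value at the root, and each child may be copied
   as often as there are boxes to be refuted, so that the only constraint linking
   different children is that they all refute the diamonds of the branch. *)
Lemma branch_interp_complete M p n U b (w : world M) ts :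
  interp_complete M p n U ->
  all reduced b -> all (shallow n.+1) b ->
  ~~ sat w (branch_interp U p b) ->
  (forall t, oin t ts -> falsifies t (dias b) /\ exists2 v, acc w v & tbisim p t v) ->
  exists V ks, let t := TNode V (ts ++ ks) in tbisim p t w /\ falsifies t b.
Proof.
move=> Ucomp rb sb; rewrite sat_branch_interp !negb_or.
move=> /and3P[/hasPn nlit ndia /hasPn nbox] tsP.
have sd : all (shallow n) (dias b) by apply: dias_shallow.
have [v|vs [vs1 vs2]] := @finite_image _ tree
    (fun v t => tbisim p t v /\ falsifies t (dias b)) (enum (acc w)).
  rewrite mem_enum => wv; have [|t] := Ucomp (dias b) v sd; last by exists t.
  by apply: contraNN ndia => vd; apply/sat_diaP; exists v.
have [f|fs [fs1 fs2]] := @finite_image _ tree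
    (fun f t => (exists2 v, acc w v & tbisim p t v) /\ falsifies t (f :: dias b)) (boxes b).
  move=> fb; have := nbox f fb; rewrite negb_forall => /existsP[v].
  rewrite negb_imply => /andP[wv vU]; have [|//|t] := Ucomp (f :: dias b) v.
    rewrite /= sd andbT; apply: (allP sb (Box f)); by rewrite -mem_boxes.
  by exists t => //; split=> //; exists v.
pose V q := if q == p then Neg p \in b else w \in valuation M q.
(* Besides the prescribed children [ts], [vs] has a counterpart for every successor of [w] and [fs]
   a refuting child for every box. *)
exists V, (vs ++ fs) => /=.
have ksP k : oin k (ts ++ vs ++ fs) ->
    falsifies k (dias b) /\ exists2 v, acc w v & tbisim p k v.
  move=> /oin_cat[/tsP//|/oin_cat[/vs2[v]|/fs2[f _ [kv]]]].
    by rewrite mem_enum => wv [kv kd]; split=> //; exists v.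
  by rewrite /falsifies /= negb_or => /andP[_ kd].
split.
  constructor=> /= [q /negPf qp|k /ksP[]//|v wv]; first by rewrite /V qp.
  have [|k kvs [kv _]] := vs1 v; first by rewrite mem_enum.
  by exists k => //; apply/oin_cat; right; apply/oin_cat; left.
apply: falsifies_branch => // [|q qb|q qb|f fb|k /ksP[]//].
- by apply/negP => Tb; have := nlit _ (map_f _ Tb).
- have := nlit _ (map_f _ qb); rewrite /V /=.
  by case: eqP => [_|_ //]; case: ifP.
- have := nlit _ (map_f _ qb); rewrite /V /=.
  by case: eqP => [<-//|_]; rewrite /= negbK.
- have [|k kfs [_]] := fs1 f; first by rewrite mem_boxes.
  rewrite /falsifies /= negb_or => /andP[kf _].
  by exists k => //; apply/oin_cat; right; apply/oin_cat; right.
Qed.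

Lemma seq_interp_complete M p n :
  K_model M -> interp_complete M p n (seq_interp p n).
Proof.
move=> KM; elim: n => [|n IHn] F w.
  by case: F => // _ _; have [t tw] := unravelling p w KM; exists t.
move=> /cls_shallow/allP sF; rewrite /= sat_conj all_map -has_predC => /hasP[b bF nb].
have [||V [ks [tw tb]]] := branch_interp_complete IHn _ (sF b bF) nb (ts := [::]).
- exact: (allP (cls_reduced F)).
- by move=> t [[]].
exists (TNode V ks) => //.
exact: falsifies_cls tb.
Qed.

(** * Multiformula interpolants of nested sequents *)

Definition mdisj (s : label) : seq mform -> mform := foldr MOr (MForm s Bot).
(** As in [mdisj], the label only serves the closing constant, which must stand at a node of the
    sequent. *)
Definition mconj (s : label) : seq mform -> mform := foldr MAnd (MForm s Top).

(* The interpolant of [G] with root label [s] and with the formulas [E] added at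
   its root. *)
Fixpoint nested_interp (p : atom) (G : nested) : label -> seq form -> mform :=
  let: Node F B := G in
  let As := [seq nested_interp p D | D <- B] in
  fun s E =>
  mconj s [seq MOr (MForm s (branch_interp (seq_interp p (rank b)) p b))
    (mdisj s [seq nth (fun s _ => MForm s Bot) As i (rcons s i.+1) (dias b)
             | i <- iota 0 (size B)])
    | b <- cls (E ++ F)].

(** Decidability allows a failing conjunct to be extracted from a failing conjunction without
    classical logic. *)
Lemma msat_dec M (I : label -> world M) A : msat I A \/ ~ msat I A.
Proof.
elim: A => [s f|A IHA B IHB|A IHA B IHB] /=; try tauto.
by case: (sat (I s) f); [left | right].
Qed.

Lemma msat_mdisj M (I : label -> world M) s As :
  msat I (mdisj s As) <-> exists2 A, oin A As & msat I A.
Proof.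
elim: As => [|A As IHA] /=; first by split=> // -[A [[]]].
split=> [[IA|/IHA[A' A's IA']]|[A' /oin_cons[->|A's] IA']].
- by exists A => //; apply/oin_cons; left.
- by exists A' => //; apply/oin_cons; right.
- by left.
- by right; apply/IHA; exists A'.
Qed.

Lemma msat_mconj M (I : label -> world M) s As :
  msat I (mconj s As) <-> forall A, oin A As -> msat I A.
Proof.
elim: As => [|A As IHA] /=; first by split=> // _ A [[]].
split=> [[IA /IHA IAs] A' /oin_cons[->//|/IAs//]|H].
split; first by apply: H; apply/oin_cons; left.
by apply/IHA => A' A's; apply: H; apply/oin_cons; right.
Qed.

Lemma not_msat_mconj M (I : label -> world M) s As :
  ~ msat I (mconj s As) -> exists2 A, oin A As & ~ msat I A.
Proof.
move=> nAs; have [|//|/msat_mconj//] := @or_forall _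
    (exists2 A, oin A As & ~ msat I A) (msat I) As.
by move=> A AAs; case: (msat_dec I A) => [|nA]; [right | left; exists A].
Qed.

Lemma oin_map T U (f : T -> U) s y :
  oin y (map f s) <-> exists2 x, oin x s & y = f x.
Proof.
split=> [[i]|[x [i si] ->]]; last by exists i; rewrite onth_map si.
rewrite onth_map; case si: (onth s i) => [x|] //= [<-].
by exists x => //; exists i.
Qed.

(** Indices stay below [size B], so the default of [nth] is never met; indices start at 0 and labels
    at 1, whence [i.+1]. *)
Lemma oin_kid_interps p B s E A :
  oin A [seq nth (fun s _ => MForm s Bot) [seq nested_interp p D | D <- B] i
           (rcons s i.+1) E | i <- iota 0 (size B)] <->
  exists i D, onth B i = Some D /\ A = nested_interp p D (rcons s i.+1) E.
Proof.
split=> [/oin_map[i /oin_mem]|[i [D [Bi ->]]]].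
  rewrite mem_iota /= => iB ->; have: onth B i by rewrite onthTE.
  case Bi: (onth B i) => [D|] // _; exists i, D; split=> //.
  by rewrite (onth_nth _ (nested_interp p D)) // onth_map Bi.
apply/oin_map; exists i; first by apply/oin_mem; rewrite mem_iota /= -onthTE Bi.
by rewrite (onth_nth _ (nested_interp p D)) // onth_map Bi.
Qed.

Lemma msat_nested_interp M (I : label -> world M) p F B s E :
  msat I (nested_interp p (Node F B) s E) <->
  forall b, b \in cls (E ++ F) ->
    sat (I s) (branch_interp (seq_interp p (rank b)) p b) \/
    exists i D, onth B i = Some D /\ msat I (nested_interp p D (rcons s i.+1) (dias b)).
Proof.
rewrite [nested_interp _ _]/=; split=> [/msat_mconj H b bF|H].
  have /= := H _ ((oin_map _ _ _).2 (ex_intro2 _ _ b ((oin_mem _ _).2 bF) erefl)).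
  by case=> [|/msat_mdisj[A /oin_kid_interps[i [D [Bi ->]]] IA]]; [left | right; exists i, D].
apply/msat_mconj => A /oin_map[b /oin_mem/H bI ->] /=.
case: bI => [|[i [D [Bi ID]]]]; [by left | right].
apply/msat_mdisj; exists (nested_interp p D (rcons s i.+1) (dias b)) => //.
by apply/oin_kid_interps; exists i, D.
Qed.

Definition box_nodes (s : label) : nat -> seq nested -> seq (label * seq form) :=
  fix go i B := if B is D :: B' then nodes_from (rcons s i) D ++ go i.+1 B' else [::].

Lemma nodes_fromP x s F B :
  x \in nodes_from s (Node F B) <->
  x = (s, F) \/ exists i D, onth B i = Some D /\ x \in nodes_from (rcons s i.+1) D.
Proof.
have boxP n : x \in box_nodes s n B <->
    exists i D, onth B i = Some D /\ x \in nodes_from (rcons s (n + i)) D.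
  elim: B n => [|D B IHB] n /=; first by split=> // -[[|i] [D []]].
  rewrite mem_cat; split=> [/orP[xD|/IHB[i [D' [Bi xD']]]]|[[|i] [D' [/= Bi]]]].
  - by exists 0, D; rewrite addn0.
  - by exists i.+1, D'; rewrite addnS.
  - by case: Bi => ->; rewrite addn0 => ->.
  - by rewrite addnS -addSn => xD'; apply/orP; right; apply/IHB; exists i, D'.
(* [box_nodes] is convertible to the anonymous fixpoint inside [nodes_from]. *)
have -> : nodes_from s (Node F B) = (s, F) :: box_nodes s 1 B by [].
rewrite inE; split=> [/predU1P[->|/(boxP 1)]|[->|/(boxP 1)->]]; rewrite ?eqxx ?orbT //.
  by left.
by right.
Qed.

Definition labels_from s G : seq label := [seq n.1 | n <- nodes_from s G].

Lemma labels_fromP l s F B :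
  l \in labels_from s (Node F B) <->
  l = s \/ exists i D, onth B i = Some D /\ l \in labels_from (rcons s i.+1) D.
Proof.
split=> [/mapP[x /nodes_fromP[->|[i [D [Bi xD]]]] ->]|[->|[i [D [Bi]]]]].
- by left.
- by right; exists i, D; rewrite map_f.
- by apply/mapP; exists (s, F) => //; apply/nodes_fromP; left.
- move=> /mapP[x xD ->]; apply: map_f; apply/nodes_fromP.
  by right; exists i, D.
Qed.

Lemma labels_from_root s G : s \in labels_from s G.
Proof. by case: G => F B; apply/labels_fromP; left. Qed.

Definition interp_from M (I : label -> world M) s G : Prop :=
  forall x n, x \in labels_from s G -> rcons x n \in labels_from s G ->
    acc (I x) (I (rcons x n)).

Lemma interp_from_kid M (I : label -> world M) s F B i D :
  interp_from I s (Node F B) -> onth B i = Some D ->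
  acc (I s) (I (rcons s i.+1)) /\ interp_from I (rcons s i.+1) D.
Proof.
move=> IG Bi; have sub l : l \in labels_from (rcons s i.+1) D ->
    l \in labels_from s (Node F B).
  by move=> lD; apply/labels_fromP; right; exists i, D.
split; first by apply: IG; [apply: labels_from_root | apply/sub/labels_from_root].
by move=> x n /sub xG /sub; apply: IG.
Qed.

Lemma nested_interp_labels p G s E :
  {subset mlabels (nested_interp p G s E) <= labels_from s G}.
Proof.
elim/nested_onth_ind: G s E => F B IHB s E l.
have labs As (sAs : forall A, oin A As -> {subset mlabels A <= labels_from s (Node F B)}) :
    {subset mlabels (mdisj s As) <= labels_from s (Node F B)} /\
    {subset mlabels (mconj s As) <= labels_from s (Node F B)}.
  elim: As sAs => [|A As IHA] sAs /=.
    by split=> x; rewrite inE => /eqP->; apply: labels_from_root.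
  have [|hd hc] := IHA; first by move=> A' A's; apply: sAs; apply/oin_cons; right.
  have hA := sAs A ((oin_cons _ _ _).2 (or_introl erefl)).
  by split=> x; rewrite mem_cat => /orP[/hA|] //; [apply: hd | apply: hc].
apply: (labs _ _).2 => A /oin_map[b _ ->] {}l /=.
rewrite inE => /predU1P[->|]; first exact: labels_from_root.
apply: (labs _ _).1 => {}A /oin_kid_interps[i [D [Bi ->]]] {}l lD.
apply/labels_fromP; right; exists i, D; split=> //; apply: IHB lD.
by exists i.
Qed.

(** * Variables of the interpolants *)

Definition over (S : pred atom) : pred form := fun f => all S (fvars f).

Definition avoiding (p : atom) (S : pred atom) : pred atom := [pred q | S q && (q != p)].

Lemma all_fvars_disj S F : all S (fvars (foldr Or Bot F)) = all (over S) F.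
Proof. by elim: F => //= f F IHF; rewrite all_cat IHF. Qed.

Lemma all_fvars_conj S F : all S (fvars (foldr And Top F)) = all (over S) F.
Proof. by elim: F => //= f F IHF; rewrite all_cat IHF. Qed.

Lemma cls_over S F : all (over S) F -> all (all (over S)) (cls F).
Proof. by apply: cls_all => g h; rewrite /over /= all_cat. Qed.

Lemma dias_over S b : all (over S) b -> all (over S) (dias b).
Proof. by move/allP => sb; apply/allP => f; rewrite mem_dias => /sb. Qed.

Lemma branch_interp_over S p U b :
  (forall F, all (over S) F -> over (avoiding p S) (U F)) ->
  all (over S) b -> over (avoiding p S) (branch_interp U p b).
Proof.
move=> US bS; rewrite /over all_fvars_disj all_cat /= all_map; apply/and3P; split.
- apply/allP => f /(allP bS); rewrite /over.
  by case: f => //= q; case: eqP => [_|/eqP qp] /=; rewrite ?andbT /avoiding /= ?qp ?andbT //;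
    case: ifP.
- by apply: US; apply: dias_over.
- rewrite all_map; apply/allP => f; rewrite mem_boxes => /(allP bS) fS.
  by apply: US; rewrite /= dias_over // andbT.
Qed.

Lemma seq_interp_over S p n F :
  all (over S) F -> over (avoiding p S) (seq_interp p n F).
Proof.
elim: n F => //= n IHn F /cls_over/allP FS; rewrite /over all_fvars_conj all_map.
by apply/allP => b /FS; apply: branch_interp_over.
Qed.

Lemma nested_interp_over S p G s E :
  all (over S) E -> all S (svars G) ->
  all (avoiding p S) (mvars (nested_interp p G s E)).
Proof.
elim/nested_onth_ind: G s E => F B IHB s E ES.
rewrite [svars _]/= all_cat => /andP[FS BS].
have vars As (sAs : forall A, oin A As -> all (avoiding p S) (mvars A)) :
    all (avoiding p S) (mvars (mdisj s As)) && all (avoiding p S) (mvars (mconj s As)).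
  elim: As sAs => //= A As IHA sAs; rewrite !all_cat.
  have /andP[-> ->] : _ := IHA (fun A' A's => sAs A' ((oin_cons _ _ _).2 (or_intror A's))).
  by rewrite sAs //; apply/oin_cons; left.
have EFS : all (over S) (E ++ F).
  rewrite all_cat ES; apply/allP => f fF; apply/allP => q qf.
  by apply: (allP FS); apply/flatten_mapP; exists f.
apply: (andP (vars _ _)).2 => A /oin_map[b /oin_mem/(allP (cls_over EFS)) bS ->] /=.
rewrite all_cat; apply/andP; split.
  by apply: branch_interp_over bS => F'; apply: seq_interp_over.
apply: (andP (vars _ _)).1 => {}A /oin_kid_interps[i [D [Bi ->]]].
apply: IHB; [by exists i | exact: dias_over |].
elim: B i Bi BS => [|D' B IHB] [|i] //= Bi; rewrite all_cat => /andP[DS BS].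
  by case: Bi => <-.
exact: IHB Bi BS.
Qed.

(** * Correctness of the interpolants *)

Lemma nested_interp_sound M (I : label -> world M) p G s E :
  interp_from I s G -> msat I (nested_interp p G s E) ->
  has (sat (I s)) E \/ exists l F, (l, F) \in nodes_from s G /\ has (sat (I l)) F.
Proof.
elim/nested_onth_ind: G s E => F B IHB s E IG /msat_nested_interp IA.
have [|nEF] := boolP (has (sat (I s)) (E ++ F)).
  rewrite has_cat => /orP[|IF]; [by left | right; exists s, F; split=> //].
  by apply/nodes_fromP; left.
move: (nEF); rewrite -(cls_has _ (sat_boolean (I s))) -has_predC => /hasP[b bF /= nb].
case: (IA b bF) => [/branch_interp_sound bs|[i [D [Bi ID]]]].
  by rewrite bs // in nb => F' v; apply: seq_interp_sound.
have [si ID'] := interp_from_kid IG Bi.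
have [|/hasP[f]|[l [F' [lD IF']]]] := IHB D _ _ _ ID' ID; first by exists i.
  (* A formula of [dias b] true at the child makes its diamond true at [I s], although [b] was
     chosen to be false there. *)
  rewrite mem_dias => fb If; case/hasP: nb; exists (Dia f) => //.
  by apply/sat_diaP; exists (I (rcons s i.+1)).
by right; exists l, F'; split=> //; apply/nodes_fromP; right; exists i, D.
Qed.

Section Refutation.

Variables (M : model) (p : atom) (I : label -> world M).

(* The [i]-th child of [t] refutes the [i]-th box of the sequent, so that labels
   of the sequent are positions of [t] up to the label of the root. *)
Inductive refutes : label -> nested -> tree -> Prop :=
  Refutes s F B t of falsifies t F & tbisim p t (I s) &
    (forall i D, onth B i = Some D ->
      exists2 k, onth (kids t) i = Some k & refutes (rcons s i.+1) D k) :
  refutes s (Node F B) t.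

(** A failing conjunct selects a branch [b]. The trees obtained recursively for the brackets refute
    [dias b], so they may be prescribed as children in [branch_interp_complete]. *)
Lemma nested_interp_complete G s E :
  K_model M -> interp_from I s G -> ~ msat I (nested_interp p G s E) ->
  exists2 t, falsifies t E & refutes s G t.
Proof.
move=> KM; elim/nested_onth_ind: G s E => F B IHB s E IG nA.
have [_ /oin_map[b /oin_mem bF ->] /= nb] := not_msat_mconj nA.
have {nA} nbs : ~~ sat (I s) (branch_interp (seq_interp p (rank b)) p b).
  by apply/negP => h; apply: nb; left.
have nbB i D : onth B i = Some D -> ~ msat I (nested_interp p D (rcons s i.+1) (dias b)).
  move=> Bi ID; apply: nb; right; apply/msat_mdisj.
  exists (nested_interp p D (rcons s i.+1) (dias b)) => //.
  by apply/oin_kid_interps; exists i, D.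
have [i D Bi|ts szts tsP] := @finite_choice _ tree
    (fun i D t => falsifies t (dias b) /\ refutes (rcons s i.+1) D t) B.
  have [_ ID] := interp_from_kid IG Bi.
  by have [|t] := IHB D _ _ _ ID (nbB _ _ Bi); [exists i | exists t].
have [|||V [ks [tw tb]]] := branch_interp_complete
    (@seq_interp_complete _ p (rank b) KM) _ _ nbs (ts := ts).
- exact: (allP (cls_reduced (E ++ F))).
- exact: sub_shallow (rank_shallow b).
- move=> t [i ti]; have [D Bi] := onth_size_eq (esym szts) ti.
  have [tb tD] := tsP _ _ _ Bi ti; split=> //.
  have [si _] := interp_from_kid IG Bi; exists (I (rcons s i.+1)) => //.
  by case: tD.
have := falsifies_cls bF tb; rewrite {1}/falsifies has_cat negb_or => /andP[tE tF].
exists (TNode V (ts ++ ks)) => //; constructor=> // i D Bi.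
have [t ti] := onth_size_eq szts Bi; exists t; last by have [] := tsP _ _ _ Bi ti.
(* The trees [ts] stand first, so the child with index [i] belongs to the bracket with index [i]. *)
by rewrite onth_cat -onthTE ti.
Qed.

Lemma refutes_inv s G t :
  refutes s G t -> let: Node F B := G in
  [/\ falsifies t F, tbisim p t (I s) &
      forall i D, onth B i = Some D ->
      exists2 k, onth (kids t) i = Some k & refutes (rcons s i.+1) D k].
Proof. by case. Qed.

Lemma refutes_nodes s G t l F :
  refutes s G t -> (l, F) \in nodes_from s G ->
  exists x k, [/\ l = s ++ x, subtree t x = Some k, falsifies k F & tbisim p k (I l)].
Proof.
elim/nested_onth_ind: G s t => F' B IHB s t /refutes_inv[tF ts tB] /nodes_fromP[[-> ->]|[i [D [Bi lD]]]].
  by exists [::], t; rewrite cats0.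
have [k ki kD] := tB _ _ Bi.
have [|x [k' [-> kx k'F k'l]]] := IHB D _ _ _ kD lD; first by exists i.
exists (i.+1 :: x), k'; rewrite cat_rcons in k'l *; split=> //=.
by rewrite ki.
Qed.

End Refutation.

Lemma nested_interp_BNUI p G :
  is_BNUI K_model p G (nested_interp p G root_label [::]).
Proof.
split.
- split=> [q qA|]; last exact: nested_interp_labels.
  have /allP/(_ q qA) := @nested_interp_over (mem (svars G)) p G root_label [::] isT
    (introT allP (fun q qG => qG)).
  by rewrite mem_filter /= andbC.
- move=> M I _ IG /(nested_interp_sound IG)[//|[l [F [lG /hasP[f fF If]]]]].
  exists l, f; split=> //; apply/allpairsPdep.
  by exists (l, F), f.
move=> M I KM IG nA; have [t _ tG] := nested_interp_complete KM IG nA.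
(* Labels begin with the root entry 1, positions do not, hence [behead]. The default [troot t] is
   only used off the labels of [G]. *)
pose I' l : world (tree_model t) := insubd (troot t) (behead l).
have nodeP l F : (l, F) \in nodes G ->
    [/\ val (I' l) = behead l, 0 < size l, falsifies (tat (I' l)) F &
        tbisim p (tat (I' l)) (I l)].
  move=> lG; have [x [k [lE tx kF kl]]] := refutes_nodes tG lG.
  have I'l : I' l = at_pos tx.
    by apply: val_inj; rewrite /I' lE insubdK // mem_positions tx.
  by rewrite I'l tat_at_pos; split=> //; rewrite lE.
exists (tree_model t), I'; split.
- exact: tree_model_K.
- move=> x n /mapP[[l F] lG ->] /mapP[[l' F'] l'G /= l'E].
  have [I'l sl _ _] := nodeP _ _ lG; have [I'l' _ _ _] := nodeP _ _ l'G.
  apply/tree_accP; exists n; rewrite l'E I'l' I'l -l'E.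
  by case: (l) sl.
- exists (fun x w => tbisim p (tat x) w); last first.
    by move=> l /mapP[[l' F] lG ->]; have [] := nodeP _ _ lG.
  split.
  + exists (I' root_label), (I root_label).
    have /mapP[[l F] lG ->] := labels_from_root root_label G.
    by have [] := nodeP _ _ lG.
  + by move=> x w q /tbisim_atom xq qp; rewrite inE xq.
  + move=> x w y /tbisim_back xw xy; apply: xw; apply/oin_kidsP.
    by exists y.
  + by move=> x w v /tbisim_forth xw /xw[k /oin_kidsP[y xy <-]]; exists y.
move=> [l [f [/allpairsPdep[[l' F] [f' [lG f'F [-> ->]]]]]]].
have [_ _ /hasPn tF _] := nodeP _ _ lG.
by rewrite sat_tree_model (negPf (tF _ f'F)).
Qed.

Theorem theorem4 : has_BNUIP NK K_model.
Proof.
split; first exact: NK_sound_and_complete.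
by move=> G p; exists (nested_interp p G root_label [::]); apply: nested_interp_BNUI.
Qed.
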